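(* Let $n\ge 1$, let $x_0,\dots,x_n$ be distinct real numbers, let $0\le m\le n-1$, and let $\beta_0^{(m+1)},\dots,\beta_n^{(m+1)}$ be real numbers. Define $\beta_0^{(m)},\dots,\beta_n^{(m)}$ by $$\beta_k^{(m)}=\beta_k^{(m+1)}-x_m\,\beta_{k+1}^{(m+1)}\qquad (m\le k\le n-1),$$ and $\beta_k^{(m)}=\beta_k^{(m+1)}$ for the remaining indices, that is, for $0\le k\le m-1$ and for $k=n$. Then $u_n^{(m)}(x)=u_n^{(m+1)}(x)$ as polynomials in $x$, i.e. $$\sum_{k=0}^{m-1}\beta_k^{(m)}\prod_{j=0}^{k-1}(x-x_j)+\sum_{k=m}^{n}\beta_k^{(m)}x^{k-m}\prod_{j=0}^{m-1}(x-x_j)$$ $$=\sum_{k=0}^{m}\beta_k^{(m+1)}\prod_{j=0}^{k-1}(x-x_j)+\sum_{k=m+1}^{n}\beta_k^{(m+1)}x^{k-m-1}\prod_{j=0}^{m}(x-x_j).$$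
   Context: The numbers $x_0,\dots,x_n$ are interpolation nodes. For $0\le m\le n$ and coefficients $\beta_0^{(m)},\dots,\beta_n^{(m)}$, the intermediate polynomial $u_n^{(m)}(x)$ is defined by $$u_n^{(m)}(x)=\sum_{k=0}^{m-1}\beta_k^{(m)}\prod_{j=0}^{k-1}(x-x_j)+\sum_{k=m}^{n}\beta_k^{(m)}x^{k-m}\prod_{j=0}^{m-1}(x-x_j).$$ Empty products equal $1$ and empty sums equal $0$. Thus $u_n^{(n)}(x)=\sum_{k=0}^n\beta_k^{(n)}\prod_{j=0}^{k-1}(x-x_j)$ is the Newton form of a polynomial, and $u_n^{(0)}(x)=\sum_{k=0}^n\beta_k^{(0)}x^k$ is the monomial form. *)

(* Defs.v *)
From mathcomp Require Import all_boot all_order all_algebra.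
From mathcomp Require Import reals.

Set Implicit Arguments.
Unset Strict Implicit.
Unset Printing Implicit Defensive.

Import GRing.Theory.
Local Open Scope ring_scope.

(* Nodes and coefficients are sequences nat -> R of which, for m <= n, only the
   entries of index at most n occur. In the second sum m <= k, so the natural
   number subtraction k - m is never truncated. *)
Definition intermediate_poly (R : realType) (x : nat -> R) (n m : nat)
    (beta : nat -> R) : {poly R} :=
  \sum_(0 <= k < m) beta k *: \prod_(0 <= j < k) ('X - (x j)%:P)
  + \sum_(m <= k < n.+1)
      beta k *: ('X^(k - m) * \prod_(0 <= j < m) ('X - (x j)%:P)).

(* Main.v *)
(* With P the product of the X - x_j for j < m, and T k = beta_k^(m+1) X^(k-m) P,
   the k-th term of the second sum at level m minus the (k+1)-st term of the
   second sum at level m+1 is T k - T (k+1). The difference of the two sums thus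
   telescopes, leaving T m, the term by which the Newton part grows. *)
Require Import Defs.
From mathcomp Require Import all_boot all_order all_algebra.
From mathcomp Require Import reals.
From mathcomp Require Import ring.

Import GRing.Theory.

Local Open Scope ring_scope.

Theorem theorem3p3 (R : realType) (n : nat) (hn : (1 <= n)%N)
  (x : nat -> R)
  (x_distinct : forall i j : nat,
     (i <= n)%N -> (j <= n)%N -> i <> j -> x i <> x j)
  (m : nat) (hm : (m <= n - 1)%N)
  (beta_m beta_m1 : nat -> R)
  (beta_mid : forall k : nat, (m <= k)%N -> (k <= n - 1)%N ->
     beta_m k = beta_m1 k - x m * beta_m1 k.+1)
  (beta_low : forall k : nat, (k < m)%N -> beta_m k = beta_m1 k)
  (beta_top : beta_m n = beta_m1 n) :
  intermediate_poly x n m beta_m = intermediate_poly x n m.+1 beta_m1.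
Proof.
have le_mn : (m <= n)%N by apply: leq_trans hm (leq_subr _ _).
rewrite /intermediate_poly [in RHS]big_nat_recr //= -addrA; congr (_ + _).
  by apply: eq_big_nat => k /andP[_ lt_km]; rewrite beta_low.
set P := \prod_(0 <= j < m) ('X - (x j)%:P).
pose T k := beta_m1 k *: ('X^(k - m) * P).
(* The top coefficient is unchanged, so the term [k = n] is exactly [T n]; the remaining indices are
   those covered by [beta_mid]. *)
rewrite big_nat_recr //= beta_top -/(T n).
have -> : beta_m1 m *: P = T m by rewrite /T subnn expr0 mul1r.
(* Shifting the right-hand index and expanding [T n - T m] as a sum of [T k.+1 - T k] puts every sum
   over [m <= k < n], so terms can be compared one by one. *)
rewrite big_add1 /= addrC -[T n](subrK (T m)) -telescope_sumr //.
rewrite [_ + T m]addrC -addrA -big_split /=; congr (_ + _).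
apply: eq_big_nat => k /andP[le_mk lt_kn].
rewrite beta_mid //; last by rewrite subn1 -ltnS prednK.
(* The extra factor ['X - (x m)%:P] splits the right-hand term into [T k.+1] and the [x m]
   correction in [beta_m k]. Scalings become products by constants for [ring]. *)
rewrite big_nat_recr //= -/P subSS /T subSn // exprS -!mul_polyC rmorphB rmorphM /=.
ring.
Qed.
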